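(* Consider tuples $(q,Q,S,\gamma,w)$ consisting of real numbers $q,Q,S$ with $0<q<Q<S$, a number $\gamma\in\mathbb{R}$, and a continuously differentiable function $w:\mathbb{R}^+\to\mathbb{R}$ (where $\mathbb{R}^+=[0,\infty)$) such that $$\tfrac12\sigma^2 w'(x)+\pi(w(x))+h(x)=\gamma\quad\text{for } x\in[0,S],$$ $$\int_0^{q}\big[w(x)+k\big]\,\mathrm{d}x=-K,\qquad \int_{Q}^{S}\big[w(x)-\ell\big]\,\mathrm{d}x=L,\qquad w(q)=-k,\qquad w(Q)=w(S)=\ell.$$ The (optimal impulse control) parameters $q$, $Q$, $S$ and the function $w(\cdot)$ are unique: if $(q_1,Q_1,S_1,\gamma_1,w_1)$ and $(q_2,Q_2,S_2,\gamma_2,w_2)$ are two such tuples, then $q_1=q_2$, $Q_1=Q_2$, $S_1=S_2$, and $w_1=w_2$.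
   Context: $\sigma^2>0$; $K,k,L,\ell>0$ are constants; $\mathcal{U}\subset\mathbb{R}$ is a compact set (discrete or an interval) with finite smallest element $\underline{\mu}$ and finite largest element $\bar{\mu}$; $c$ is a real-valued function on $\mathcal{U}$, on which no condition is imposed; $h:[0,\infty)\to\mathbb{R}$ is strictly increasing and continuous with $h(0)=0$ and $\lim_{x\to\infty}h(x)=\infty$. For $w\in\mathbb{R}$, $\pi(w)=\min_{\mu\in\mathcal{U}}(\mu w+c(\mu))$.
   Formalization: Equality of w_1 and w_2 is stated only on [0,S] (S the common value), not on all of R^+: beyond S the conditions require only that w be continuously differentiable, so w can be changed there (e.g. by adding (x-S)^2 for x>S) and full equality is false. *)

(* Defs.v *)
From Stdlib Require Import Reals.
From Coquelicot Require Import Coquelicot.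
Open Scope R_scope.

Definition Rplus_set (x : R) : Prop := 0 <= x.

(** [w] is continuously differentiable on [0, oo) with derivative [dw].
    [D_in] is differentiability within the set, so the derivative at [0] is
    one-sided and the values of [w] at negative reals are irrelevant. *)
Definition is_C1_derivative (w dw : R -> R) : Prop :=
  (forall x, 0 <= x -> D_in w dw Rplus_set x) /\ continuous_on Rplus_set dw.

Definition discrete_set (U : R -> Prop) : Prop :=
  forall x, U x -> locally x (fun y => U y -> y = x).

Definition interval_set (U : R -> Prop) : Prop :=
  forall x y z, U x -> U z -> x <= y <= z -> U y.

Definition drift_set (U : R -> Prop) (mu_min mu_max : R) : Prop :=
  compact U /\ (discrete_set U \/ interval_set U) /\
  (U mu_min /\ forall mu, U mu -> mu_min <= mu) /\
  (U mu_max /\ forall mu, U mu -> mu <= mu_max).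

(** [h : [0, oo) -> R] is represented by a total function of which only the
    values on [0, oo) matter. *)
Definition holding_cost (h : R -> R) : Prop :=
  (forall x y, 0 <= x -> x < y -> h x < h y) /\
  continuous_on Rplus_set h /\
  h 0 = 0 /\
  is_lim h p_infty p_infty.

(** min over [mu] in [U] of [mu * w + c mu].  Since [c] is arbitrary, the
    minimum need not be attained; taking the greatest lower bound makes the
    function total, and it is the minimum whenever there is one (see
    [drift_min_eq]).  For a nonempty bounded [U] the bound is finite either for
    every [w] or for no [w]; in the latter case [real] returns [0]. *)
Definition drift_min (U : R -> Prop) (c : R -> R) (w : R) : R :=
  real (Glb_Rbar (fun y => exists mu, U mu /\ y = mu * w + c mu)).

Lemma drift_min_eq (U : R -> Prop) (c : R -> R) (w mu0 : R) :
  U mu0 ->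
  (forall mu, U mu -> mu0 * w + c mu0 <= mu * w + c mu) ->
  drift_min U c w = mu0 * w + c mu0.
Proof.
intros H0 Hmin; unfold drift_min.
rewrite (is_glb_Rbar_unique _ (Finite (mu0 * w + c mu0))); [reflexivity|].
split.
- intros y [mu [Hmu ->]]; exact (Hmin mu Hmu).
- intros b Hb; apply Hb; exists mu0; split; [exact H0 | reflexivity].
Qed.

(** The derivative [dw] is determined by [w] on [0, oo).  To the right of [S]
    nothing but continuous differentiability constrains [w], so uniqueness of
    [w] can only be meant on [0, S]. *)
Definition free_boundary_solution
    (sigma K k L l : R) (U : R -> Prop) (c h : R -> R)
    (q Q S gamma : R) (w : R -> R) : Prop :=
  0 < q /\ q < Q /\ Q < S /\
  (exists dw : R -> R,
     is_C1_derivative w dw /\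
     forall x, 0 <= x <= S ->
       1 / 2 * sigma ^ 2 * dw x + drift_min U c (w x) + h x = gamma) /\
  RInt (fun x => w x + k) 0 q = - K /\
  RInt (fun x => w x - l) Q S = L /\
  w q = - k /\
  w Q = l /\
  w S = l.

(* Main.v *)
(** Subtracting the equations at two points of one level set of [w], or along
    two solutions, leaves only [h], [gamma] and differences of [pi]; since [h] is
    strictly increasing and [pi] is Lipschitz, a Gronwall comparison shows that
    [w] is strictly quasi-concave and that, when [gamma1 < gamma2], [w1 < w2]
    holds to the right of any point where [w1 <= w2].  The integral condition up
    to [q] forbids [w1 < w2] on the whole of (0, min(q1, q2)), and also the
    reverse.  So for equal [gamma] the solutions agree at 0, hence everywhere,
    while for [gamma1 < gamma2] they cross before [q1] and [q2]; then [w1 < w2]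
    beyond, the interval from [Q1] to [S1] lies inside the one from [Q2] to [S2],
    and the integral condition between [Q] and [S] fails for one of them. *)

Require Import Defs.
From Stdlib Require Import Reals Lra Classical.
From Coquelicot Require Import Coquelicot.
Open Scope R_scope.

(** * Derivative sign tests and Gronwall comparisons *)

Lemma derive_neg_gt_left (f : R -> R) (a x d : R) :
  is_derive f x d -> d < 0 -> a < x -> exists y, a < y < x /\ f x < f y.
Proof.
intros Hf Hd Hax.
apply is_derive_Reals in Hf.
destruct (Hf (- d)) as [delta Hdelta]; [lra|].
assert (Hp := cond_pos delta).
set (t := Rmin (delta / 2) ((x - a) / 2)).
assert (Ht : 0 < t) by (apply Rmin_glb_lt; lra).
assert (Ht1 : t <= delta / 2) by apply Rmin_l.
assert (Ht2 : t <= (x - a) / 2) by apply Rmin_r.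
exists (x + - t); split; [lra|].
specialize (Hdelta (- t)).
rewrite Rabs_Ropp, (Rabs_pos_eq t) in Hdelta by lra.
specialize (Hdelta ltac:(lra) ltac:(lra)).
apply Rabs_def2 in Hdelta.
destruct Hdelta as [Hlt _].
assert (Hq : (f (x + - t) - f x) / - t < 0) by lra.
apply Rnot_le_lt; intros Hle.
assert (0 <= (f (x + - t) - f x) / - t); [|lra].
replace ((f (x + - t) - f x) / - t) with ((f x - f (x + - t)) / t) by (field; lra).
apply Rdiv_le_0_compat; lra.
Qed.

Lemma derive_pos_lt_left (f : R -> R) (a x d : R) :
  is_derive f x d -> 0 < d -> a < x -> exists y, a < y < x /\ f y < f x.
Proof.
intros Hf Hd Hax.
destruct (derive_neg_gt_left (fun y => - f y) a x (- d)) as [y [Hy Hlt]].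
- apply (is_derive_opp (V := R_NormedModule)); exact Hf.
- lra.
- exact Hax.
- exists y; split; [exact Hy | lra].
Qed.

Lemma continuous_le0_left (f : R -> R) (a x : R) :
  continuous f x -> a < x -> (forall y, a < y < x -> f y <= 0) -> f x <= 0.
Proof.
intros Hf Hax Hle; apply Rnot_lt_le; intros Hpos.
apply continuity_pt_filterlim in Hf.
destruct (Hf (f x) Hpos) as [alp [Halp H]].
simpl in H; unfold Rdist in H.
set (t := Rmin (alp / 2) ((x - a) / 2)).
assert (Ht : 0 < t) by (apply Rmin_glb_lt; lra).
assert (Ht1 : t <= alp / 2) by apply Rmin_l.
assert (Ht2 : t <= (x - a) / 2) by apply Rmin_r.
specialize (Hle (x - t) ltac:(lra)).
assert (Habs : Rabs (f (x - t) - f x) < f x); [|apply Rabs_def2 in Habs; lra].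
apply H; split; [split; [exact I | intros E; lra]|].
replace (x - t - x) with (- t) by ring.
rewrite Rabs_Ropp, Rabs_pos_eq; lra.
Qed.

(** Subtract a small linear term from [f x * exp (- M * x)]. If [f] were positive somewhere, the
    result would have a positive maximum; the differential inequality makes the derivative negative
    there, so a larger value lies to its left. *)
Lemma gronwall_le (M : R) (f df : R -> R) (a b : R) :
  (forall x, continuous f x) ->
  (forall x, a < x <= b -> is_derive f x (df x)) ->
  f a <= 0 ->
  (forall x, a < x <= b -> 0 < f x -> df x <= M * f x) ->
  forall x, a <= x <= b -> f x <= 0.
Proof.
intros Hc Hd Ha Hle x1 Hx1.
apply Rnot_lt_le; intros Hpos.
assert (Hax : a < x1).
{ destruct (Req_dec a x1) as [<-|]; lra. }
(* With this slope [phi x1] is exactly half of [f x1 * exp (- M * x1)]. *)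
set (e := f x1 * exp (- M * x1) / (2 * (x1 - a))).
assert (Hexp : forall y, 0 < exp (- M * y)) by (intros; apply exp_pos).
assert (He : 0 < e).
{ apply Rdiv_lt_0_compat; [apply Rmult_lt_0_compat; auto | lra]. }
(* The slope [e] makes the derivative at a maximum of [phi] strictly negative. *)
set (phi := fun y => f y * exp (- M * y) - e * (y - a)).
assert (Hphi1 : 0 < phi x1).
{ unfold phi, e.
  replace (_ - _) with (f x1 * exp (- M * x1) / 2) by (field; lra).
  assert (0 < f x1 * exp (- M * x1)) by (apply Rmult_lt_0_compat; auto).
  lra. }
assert (Hphi_cont : forall y, continuity_pt phi y).
{ intros y; apply continuity_pt_filterlim; unfold phi.
  apply (continuous_minus (fun y => f y * exp (- M * y)) (fun y => e * (y - a))).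
  - apply (continuous_mult f (fun y => exp (- M * y))); [apply Hc|].
    apply (ex_derive_continuous (fun y => exp (- M * y))); auto_derive; auto.
  - apply (ex_derive_continuous (fun y => e * (y - a))); auto_derive; auto. }
destruct (continuity_ab_maj phi a x1) as [t [Hmax Ht]]; [lra|auto|].
assert (Hphit : 0 < phi t) by (assert (phi x1 <= phi t) by (apply Hmax; lra); lra).
assert (Hat : a < t).
{ destruct (Req_dec a t) as [<-|]; [|lra].
  unfold phi in Hphit.
  assert (f a * exp (- M * a) <= 0 * exp (- M * a)).
  { apply Rmult_le_compat_r; [apply Rlt_le; auto | exact Ha]. }
  lra. }
assert (Hft : 0 < f t).
{ apply Rnot_le_lt; intros Hn; unfold phi in Hphit.
  assert (f t * exp (- M * t) <= 0 * exp (- M * t)).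
  { apply Rmult_le_compat_r; [apply Rlt_le; auto | exact Hn]. }
  assert (0 < e * (t - a)) by (apply Rmult_lt_0_compat; lra).
  lra. }
destruct (derive_neg_gt_left phi a t ((df t - M * f t) * exp (- M * t) - e))
  as [y [Hy Hlt]].
- assert (Hdt := Hd t ltac:(lra)).
  unfold phi; auto_derive.
  + exists (df t); exact Hdt.
  + change (fun y : R => f y) with f; rewrite (is_derive_unique _ _ _ Hdt); ring.
- assert (Hb := Hle t ltac:(lra) Hft).
  assert ((df t - M * f t) * exp (- M * t) <= 0 * exp (- M * t)).
  { apply Rmult_le_compat_r; [apply Rlt_le; auto | lra]. }
  lra.
- exact Hat.
- assert (phi y <= phi t) by (apply Hmax; lra); lra.
Qed.

(** The weak comparison leaves only a zero to exclude: the derivative there would be negative,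
    forcing positive values just before it. *)
Lemma gronwall_lt (M : R) (f df : R -> R) (a b : R) :
  (forall x, continuous f x) ->
  (forall x, a < x <= b -> is_derive f x (df x)) ->
  f a <= 0 ->
  (forall x, a < x <= b -> 0 <= f x -> df x < M * f x) ->
  forall x, a < x <= b -> f x < 0.
Proof.
intros Hc Hd Ha Hlt x Hx.
assert (Hle : forall y, a <= y <= b -> f y <= 0).
{ apply (gronwall_le M f df); auto.
  intros y Hy Hpos; apply Rlt_le, Hlt; lra. }
destruct (Rle_lt_or_eq_dec (f x) 0) as [|H0]; [apply Hle; lra|assumption|].
destruct (derive_neg_gt_left f a x (df x)) as [y [Hy Hfy]]; [auto| |lra|].
- assert (H := Hlt x Hx ltac:(lra)); rewrite H0 in H; lra.
- assert (f y <= 0) by (apply Hle; lra); lra.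
Qed.

(** The barrier [g] solves [g' = - M * g] and cancels [f] at [a]. Where [f + g] is positive,
    [Rabs f <= f + 2 * g], so the weak comparison applies to [f + g] and keeps [f] below [- g]. *)
Lemma gronwall_neg (M : R) (f df : R -> R) (a b : R) :
  0 <= M ->
  (forall x, continuous f x) ->
  (forall x, a < x <= b -> is_derive f x (df x)) ->
  f a < 0 ->
  (forall x, a < x <= b -> df x <= M * Rabs (f x)) ->
  forall x, a <= x <= b -> f x < 0.
Proof.
intros HM Hc Hd Ha Hle x Hx.
set (g := fun y => - f a * exp (- M * (y - a))).
assert (Hg : forall y, 0 < g y).
{ intros y; apply Rmult_lt_0_compat; [lra | apply exp_pos]. }
assert (H : f x + g x <= 0); [|specialize (Hg x); lra].
apply (gronwall_le M (fun y => f y + g y) (fun y => df y - M * g y) a b); auto.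
- intros y; apply (continuous_plus f g); auto.
  apply (ex_derive_continuous g); unfold g; auto_derive; auto.
- intros y Hy.
  apply (is_derive_plus (V := R_NormedModule) f g y (df y) (- (M * g y))); auto.
  unfold g; auto_derive; [auto | unfold Rminus; ring].
- unfold g; rewrite Rminus_diag, Rmult_0_r, exp_0; lra.
- intros y Hy Hpos; specialize (Hle y Hy); specialize (Hg y).
  assert (Habs : Rabs (f y) <= f y + g y + g y) by (apply Rabs_le; lra).
  apply (Rmult_le_compat_l M) in Habs; [lra | exact HM].
Qed.

(** * The Lipschitz bound for [drift_min] *)

Definition lipschitz (M : R) (P : R -> R) : Prop :=
  forall x y, P x - P y <= M * Rabs (x - y).

(** The affine functions under the infimum have slopes bounded by [M], so a lower bound at [u]
    becomes one at [v] after subtracting [M * Rabs (u - v)]. *)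
Lemma drift_min_lipschitz (U : R -> Prop) (c : R -> R) (M mu0 : R) :
  U mu0 -> (forall mu, U mu -> Rabs mu <= M) ->
  lipschitz M (drift_min U c).
Proof.
intros HU HM x y; unfold drift_min.
set (E := fun w z => exists mu, U mu /\ z = mu * w + c mu).
assert (HE : forall w, E w (mu0 * w + c mu0)) by (intros w; exists mu0; auto).
assert (Hshift : forall u v mu, U mu -> mu * u - mu * v <= M * Rabs (u - v)).
{ intros u v mu Hmu; rewrite <- Rmult_minus_distr_l.
  apply Rle_trans with (1 := Rle_abs _); rewrite Rabs_mult.
  apply Rmult_le_compat_r; [apply Rabs_pos | auto]. }
assert (Hlb : forall u v r, is_lb_Rbar (E u) (Finite r) ->
  is_lb_Rbar (E v) (Finite (r - M * Rabs (u - v)))).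
{ intros u v r Hr z [mu [Hmu ->]]; simpl.
  assert (H := Hr _ (ex_intro _ mu (conj Hmu eq_refl))); simpl in H.
  specialize (Hshift u v mu Hmu); lra. }
fold (E x) (E y).
destruct (Glb_Rbar_correct (E x)) as [Hx1 Hx2].
destruct (Glb_Rbar_correct (E y)) as [Hy1 Hy2].
assert (HM0 : 0 <= M * Rabs (x - y)).
{ apply Rmult_le_pos; [|apply Rabs_pos].
  apply Rle_trans with (2 := HM mu0 HU), Rabs_pos. }
(* Nonemptiness excludes [p_infty], and the shift of lower bounds excludes one finite and one
   infinite bound. If both are [m_infty], [real] returns 0 twice and [HM0] remains. *)
destruct (Glb_Rbar (E x)) as [gx| |]; destruct (Glb_Rbar (E y)) as [gy| |];
  try (exfalso; exact (Hx1 _ (HE x))); try (exfalso; exact (Hy1 _ (HE y))); simpl.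
- assert (H := Hy2 _ (Hlb x y gx Hx1)); simpl in H; lra.
- elim (Hy2 _ (Hlb x y gx Hx1)).
- elim (Hx2 _ (Hlb y x gy Hy1)).
- lra.
Qed.

(** * Reduction to the normalized problem *)

(** The free-boundary problem divided by [sigma ^ 2 / 2], for a function that is
    continuous on the whole line. *)
Record normalized_solution (K k L l : R) (P h : R -> R)
    (q Q S gamma : R) (v : R -> R) : Prop := {
  ns_q : 0 < q;
  ns_qQ : q < Q;
  ns_QS : Q < S;
  ns_continuous : forall x, continuous v x;
  ns_ode : forall x, 0 < x <= S -> is_derive v x (gamma - P (v x) - h x);
  ns_intK : RInt (fun x => v x + k) 0 q = - K;
  ns_intL : RInt (fun x => v x - l) Q S = L;
  ns_vq : v q = - k;
  ns_vQ : v Q = l;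
  ns_vS : v S = l }.

(** The clamp [Rmax 0] is 1-Lipschitz and freezes [w] at [w 0] on negative reals, turning continuity
    within the half-line into two-sided continuity. *)
Lemma continue_in_clamp (w : R -> R) :
  (forall x, 0 <= x -> continue_in w Rplus_set x) ->
  forall x, continuous (fun y => w (Rmax 0 y)) x.
Proof.
intros Hw x; apply continuity_pt_filterlim; intros eps Heps.
destruct (Hw (Rmax 0 x) (Rmax_l 0 x) eps Heps) as [alp [Halp H]].
exists alp; split; [exact Halp|].
simpl; unfold Rdist; intros y [_ Hyx].
(* [continue_in] is a punctured limit and says nothing when the two clamped points coincide. *)
destruct (Req_dec (Rmax 0 y) (Rmax 0 x)) as [->|Hne].
- rewrite Rminus_diag, Rabs_R0; exact Heps.
- apply H; split; [split; [apply Rmax_l | auto]|].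
  simpl; unfold Rdist; apply Rle_lt_trans with (2 := Hyx).
  unfold Rmax; destruct (Rle_dec 0 y), (Rle_dec 0 x);
    unfold Rabs; repeat destruct Rcase_abs; lra.
Qed.

Lemma D_in_is_derive_clamp (w dw : R -> R) (x : R) :
  0 < x -> D_in w dw Rplus_set x -> is_derive (fun y => w (Rmax 0 y)) x (dw x).
Proof.
intros Hx Hw; apply is_derive_Reals; intros eps Heps.
destruct (Hw eps Heps) as [alp [Halp H]].
(* The cap by [x] keeps [x + t] positive, where the clamp is the identity. *)
assert (Hd : 0 < Rmin alp x) by (apply Rmin_glb_lt; lra).
exists (mkposreal _ Hd); simpl; intros t Ht Htd.
assert (Ht1 : Rabs t < alp) by (apply Rlt_le_trans with (1 := Htd), Rmin_l).
assert (Ht2 : Rabs t < x) by (apply Rlt_le_trans with (1 := Htd), Rmin_r).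
apply Rabs_def2 in Ht2.
rewrite !Rmax_right by lra.
specialize (H (x + t)); simpl in H; unfold Rdist in H.
replace (x + t - x) with t in H by ring.
apply H; split; [split|]; [unfold Rplus_set; lra | | exact Ht1].
intros E; apply Ht; lra.
Qed.

Lemma normalize_solution (sigma K k L l : R) (U : R -> Prop) (c h : R -> R)
    (q Q S gamma : R) (w : R -> R) :
  0 < sigma ^ 2 ->
  free_boundary_solution sigma K k L l U c h q Q S gamma w ->
  normalized_solution K k L l
    (fun y => drift_min U c y / (sigma ^ 2 / 2)) (fun x => h x / (sigma ^ 2 / 2))
    q Q S (gamma / (sigma ^ 2 / 2)) (fun x => w (Rmax 0 x)).
Proof.
intros Hs [Hq [HqQ [HQS [[dw [[Hdw _] Hode]] [HK [HL [Hwq [HwQ HwS]]]]]]]].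
split; auto; try (rewrite Rmax_right by lra; assumption).
- apply continue_in_clamp; intros x Hx; exact (cont_deriv w dw _ x (Hdw x Hx)).
- intros x Hx.
  replace (_ - _) with (dw x).
  + apply D_in_is_derive_clamp; [lra | apply Hdw; lra].
  + rewrite Rmax_right by lra; rewrite <- (Hode x) by lra; field.
    intros H0; rewrite H0 in Hs; simpl in Hs; lra.
- rewrite <- HK; apply RInt_ext; intros x.
  rewrite Rmin_left by lra; intros Hx; rewrite Rmax_right by lra; reflexivity.
- rewrite <- HL; apply RInt_ext; intros x.
  rewrite Rmin_left by lra; intros Hx; rewrite Rmax_right by lra; reflexivity.
Qed.

Section NormalizedUniqueness.

Context (K k L l : R) (hk : 0 < k) (hl : 0 < l).
Context (P h : R -> R) (M : R) (HM : 0 <= M) (HP : lipschitz M P).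
Context (Hh : forall x y, 0 <= x -> x < y -> h x < h y).

Notation solution := (normalized_solution K k L l P h).

(** * The shape of one solution *)

Section OneSolution.

Context (q Q S gamma : R) (v : R -> R) (Hv : solution q Q S gamma v).

(** Subtracting the equation at [m] leaves [P (v m) - P (v y)] plus [h m - h y], which is negative;
    hence the strict Gronwall inequality wherever [v m <= v y]. *)
Lemma decreasing_past_critical_point (m x : R) :
  0 < m -> gamma - P (v m) - h m = 0 -> m < x <= S -> v x < v m.
Proof.
intros Hm Hcrit Hx.
assert (H : v x + - v m < 0); [|lra].
apply (gronwall_lt M (fun y => v y + - v m) (fun y => gamma - P (v y) - h y) m S);
  [| |lra| |exact Hx].
- intros y; apply (continuous_plus v (fun _ => - v m));
    [apply (ns_continuous _ _ _ _ _ _ _ _ _ _ _ Hv) | apply continuous_const].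
- intros y Hy; rewrite <- (Rplus_0_r (_ - _ - _)).
  apply (is_derive_plus (V := R_NormedModule) v (fun _ => - v m)).
  + apply (ns_ode _ _ _ _ _ _ _ _ _ _ _ Hv); lra.
  + apply (is_derive_const (V := R_NormedModule)).
- intros y Hy Hpos.
  assert (Hlip := HP (v m) (v y)).
  rewrite Rabs_minus_sym, Rabs_pos_eq in Hlip by lra.
  assert (h m < h y) by (apply Hh; lra).
  change (v y + - v m) with (v y - v m); lra.
Qed.

(** Otherwise [v] has an interior minimum on the segment. A nonzero derivative there gives a smaller
    value on one side, and a zero derivative makes [v] fall afterwards. *)
Lemma strictly_quasiconcave (x y z : R) :
  0 <= x -> x < y -> y < z -> z <= S -> v x < v y \/ v z < v y.
Proof.
intros Hx Hxy Hyz Hz.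
apply NNPP; intros Hn; apply not_or_and in Hn; destruct Hn as [Hnx Hnz].
(* A minimum attained at an endpoint is also attained at [y], since [v y] exceeds neither end
   value. *)
assert (Hmin : exists t, x < t < z /\ forall u, x <= u <= z -> v t <= v u).
{ destruct (continuity_ab_min v x z) as [t [Ht Hxt]]; [lra| |].
  - intros u _; apply continuity_pt_filterlim.
    apply (ns_continuous _ _ _ _ _ _ _ _ _ _ _ Hv).
  - destruct (Req_dec t x) as [->|Htx].
    { exists y; split; [lra|]; intros u Hu; specialize (Ht u Hu); lra. }
    destruct (Req_dec t z) as [->|Htz].
    { exists y; split; [lra|]; intros u Hu; specialize (Ht u Hu); lra. }
    exists t; split; [lra | exact Ht]. }
destruct Hmin as [t [Hxt Ht]].
assert (Hd := ns_ode _ _ _ _ _ _ _ _ _ _ _ Hv t ltac:(lra)).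
destruct (Rtotal_order (gamma - P (v t) - h t) 0) as [Hneg|[Hcrit|Hpos]].
(* Reflection turns the test on the left into one on the right. *)
- assert (Hd' : is_derive (fun u => v (- u)) (- t) (- (gamma - P (v t) - h t))).
  { rewrite <- (Ropp_involutive t) in Hd at 1.
    evar_last;
      [apply (is_derive_comp v Ropp (- t) _ (- (1)) Hd); auto_derive; auto; ring|].
    unfold scal; simpl; unfold mult; simpl; ring. }
  destruct (derive_pos_lt_left _ (- z) _ _ Hd') as [u [Hu Hlt]]; [lra|lra|].
  rewrite Ropp_involutive in Hlt.
  assert (v t <= v (- u)) by (apply Ht; lra); lra.
- assert (v z < v t) by (apply decreasing_past_critical_point; auto; lra).
  assert (v t <= v z) by (apply Ht; lra); lra.
- destruct (derive_pos_lt_left v x t _ Hd Hpos) as [u [Hu Hlt]]; [lra|].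
  assert (v t <= v u) by (apply Ht; lra); lra.
Qed.

(** In strict quasi-concavity at [x < q < Q] the second alternative would read [l < - k]. *)
Lemma lt_k_before_q (x : R) : 0 <= x < q -> v x < - k.
Proof.
intros Hx; destruct Hv.
destruct (strictly_quasiconcave x q Q); lra.
Qed.

Lemma lt_l_before_Q (x : R) : 0 <= x < Q -> v x < l.
Proof.
intros Hx; destruct Hv.
destruct (strictly_quasiconcave x Q S); lra.
Qed.

Lemma gt_l_after_Q (x : R) : Q < x < S -> l < v x.
Proof.
intros Hx; destruct Hv.
destruct (strictly_quasiconcave Q x S); lra.
Qed.

Lemma continuous_add_const (m x : R) : continuous (fun y => v y + m) x.
Proof.
apply (continuous_plus v (fun _ => m));
  [apply (ns_continuous _ _ _ _ _ _ _ _ _ _ _ Hv) | apply continuous_const].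
Qed.

Lemma ex_RInt_add_const (m a b : R) : ex_RInt (fun y => v y + m) a b.
Proof.
apply (ex_RInt_continuous (V := R_CompleteNormedModule)).
intros; apply continuous_add_const.
Qed.

End OneSolution.

(** * Comparison of two solutions *)

(** If [q1 < q2], then [v1] reaches [- k] at [q1] while [v2] is still below it. If [q2 <= q1], the
    integral of [v1 + k] up to [q2] is below [- K], and going on to [q1] only lowers it. *)
Lemma not_lt_before_q (q1 Q1 S1 gamma1 q2 Q2 S2 gamma2 : R) (v1 v2 : R -> R) :
  solution q1 Q1 S1 gamma1 v1 -> solution q2 Q2 S2 gamma2 v2 ->
  ~ (forall x, 0 < x < Rmin q1 q2 -> v1 x < v2 x).
Proof.
intros Hv1 Hv2 Hlt.
assert (Hq1 := ns_q _ _ _ _ _ _ _ _ _ _ _ Hv1).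
assert (Hq2 := ns_q _ _ _ _ _ _ _ _ _ _ _ Hv2).
assert (HK1 := ns_intK _ _ _ _ _ _ _ _ _ _ _ Hv1).
assert (HK2 := ns_intK _ _ _ _ _ _ _ _ _ _ _ Hv2).
assert (Hint : forall T, 0 < T <= Rmin q1 q2 ->
  RInt (fun x => v1 x + k) 0 T < RInt (fun x => v2 x + k) 0 T).
{ intros T HT; apply RInt_lt; [lra| | |].
  - intros; eapply continuous_add_const; eauto.
  - intros; eapply continuous_add_const; eauto.
  - intros x Hx; specialize (Hlt x ltac:(lra)); lra. }
destruct (Rtotal_order q1 q2) as [H12|[H12|H12]].
- rewrite Rmin_left in Hlt by lra.
  assert (Hat := lt_k_before_q _ _ _ _ _ Hv2 q1 ltac:(lra)).
  assert (Hle : v1 q1 <= v2 q1); [|rewrite (ns_vq _ _ _ _ _ _ _ _ _ _ _ Hv1) in Hle; lra].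
  assert (Hsub : v1 q1 - v2 q1 <= 0); [|lra].
  apply (continuous_le0_left (fun x => v1 x - v2 x) 0); [|lra|].
  + apply (continuous_minus v1 v2).
    * apply (ns_continuous _ _ _ _ _ _ _ _ _ _ _ Hv1).
    * apply (ns_continuous _ _ _ _ _ _ _ _ _ _ _ Hv2).
  + intros x Hx; specialize (Hlt x Hx); lra.
- subst q2; assert (H := Hint q1).
  rewrite Rmin_left in H by lra; specialize (H ltac:(lra)); lra.
- assert (H := Hint q2).
  rewrite Rmin_right in H by lra; specialize (H ltac:(lra)).
  assert (HC := RInt_Chasles (fun x => v1 x + k) 0 q2 q1
    (ex_RInt_add_const _ _ _ _ _ Hv1 _ _ _) (ex_RInt_add_const _ _ _ _ _ Hv1 _ _ _)).
  change (RInt (fun x => v1 x + k) 0 q2 + RInt (fun x => v1 x + k) q2 q1 =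
          RInt (fun x => v1 x + k) 0 q1) in HC.
  assert (Hneg : 0 < RInt (fun x => - (v1 x + k)) q2 q1).
  { apply RInt_gt_0; [lra| |].
    - intros x Hx; assert (v1 x < - k) by (eapply lt_k_before_q; eauto; lra); lra.
    - intros x _; apply (continuous_opp (fun x => v1 x + k)).
      eapply continuous_add_const; eauto. }
  rewrite (RInt_opp (V := R_CompleteNormedModule) (fun x => v1 x + k)) in Hneg
    by (eapply ex_RInt_add_const; eauto).
  change (0 < - RInt (fun x => v1 x + k) q2 q1) in Hneg; lra.
Qed.

(** The [h] terms cancel in the difference of the two equations, and [gamma1 < gamma2] supplies the
    strictness. *)
Lemma lt_after_crossing (q1 Q1 S1 gamma1 q2 Q2 S2 gamma2 : R) (v1 v2 : R -> R)
    (a x : R) :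
  solution q1 Q1 S1 gamma1 v1 -> solution q2 Q2 S2 gamma2 v2 ->
  gamma1 < gamma2 -> 0 <= a -> v1 a <= v2 a -> a < x -> x <= S1 -> x <= S2 ->
  v1 x < v2 x.
Proof.
intros Hv1 Hv2 Hgamma Ha Hle Hax Hx1 Hx2.
assert (H : v1 x - v2 x < 0); [|lra].
apply (gronwall_lt M (fun y => v1 y - v2 y)
  (fun y => (gamma1 - P (v1 y) - h y) - (gamma2 - P (v2 y) - h y)) a x);
  [| |lra| |lra].
- intros y; apply (continuous_minus v1 v2).
  + apply (ns_continuous _ _ _ _ _ _ _ _ _ _ _ Hv1).
  + apply (ns_continuous _ _ _ _ _ _ _ _ _ _ _ Hv2).
- intros y Hy; apply (is_derive_minus (V := R_NormedModule) v1 v2).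
  + apply (ns_ode _ _ _ _ _ _ _ _ _ _ _ Hv1); lra.
  + apply (ns_ode _ _ _ _ _ _ _ _ _ _ _ Hv2); lra.
- intros y Hy Hpos; assert (Hlip := HP (v2 y) (v1 y)).
  rewrite Rabs_minus_sym, Rabs_pos_eq in Hlip by lra; lra.
Qed.

Lemma gamma_not_lt (q1 Q1 S1 gamma1 q2 Q2 S2 gamma2 : R) (v1 v2 : R -> R) :
  solution q1 Q1 S1 gamma1 v1 -> solution q2 Q2 S2 gamma2 v2 ->
  ~ gamma1 < gamma2.
Proof.
intros Hv1 Hv2 Hgamma.
(* Without such a point [v2 < v1] up to the smaller of [q1] and [q2], which the integral condition
   excludes. *)
destruct (classic (exists a, 0 <= a < Rmin q1 q2 /\ v1 a <= v2 a))
  as [[a [Ha Hle]]|Hn].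
2: { apply (not_lt_before_q _ _ _ _ _ _ _ _ _ _ Hv2 Hv1).
     intros x Hx; rewrite Rmin_comm in Hx.
     apply Rnot_le_lt; intros Hle; apply Hn; exists x; split; [lra | exact Hle]. }
assert (Hm1 : Rmin q1 q2 <= q1) by apply Rmin_l.
assert (Hm2 : Rmin q1 q2 <= q2) by apply Rmin_r.
assert (Hlt : forall x, a < x -> x <= S1 -> x <= S2 -> v1 x < v2 x).
{ intros x; apply (lt_after_crossing _ _ _ _ _ _ _ _ _ _ _ _ Hv1 Hv2 Hgamma);
    [lra | exact Hle]. }
assert (B1 := Hv1); assert (B2 := Hv2).
destruct B1 as [Hq1 HqQ1 HQS1 _ Hode1 _ HL1 _ HvQ1 HvS1].
destruct B2 as [Hq2 HqQ2 HQS2 _ Hode2 _ HL2 _ HvQ2 HvS2].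
assert (HS : S1 < S2).
{ apply Rnot_le_lt; intros HS.
  assert (H := Hlt S2 ltac:(lra) HS ltac:(lra)).
  (* Here [v1 S2 < v2 S2 = l], whereas [v1] is at least [l] from [Q1] to [S1]. *)
  assert (HSQ : S2 < Q1).
  { apply Rnot_le_lt; intros HQ.
    destruct (Req_dec Q1 S2) as [E|]; [rewrite <- E in *; lra|].
    destruct (Req_dec S1 S2) as [E|]; [rewrite <- E in *; lra|].
    assert (l < v1 S2) by (eapply gt_l_after_Q; eauto; lra); lra. }
  (* [v2] leaves the level [l] downwards at [S2], before [v1] reaches it upwards
     at [Q1]; this contradicts [gamma1 - h Q1 < gamma2 - h S2]. *)
  assert (Hd2 : gamma2 - P l - h S2 <= 0).
  { apply Rnot_lt_le; intros Hpos; rewrite <- HvS2 in Hpos.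
    destruct (derive_pos_lt_left v2 Q2 S2 _ (Hode2 S2 ltac:(lra)) Hpos HQS2)
      as [y [Hy Hvy]].
    assert (l < v2 y) by (eapply gt_l_after_Q; eauto); lra. }
  assert (Hd1 : 0 <= gamma1 - P l - h Q1).
  { apply Rnot_lt_le; intros Hneg; rewrite <- HvQ1 in Hneg.
    destruct (derive_neg_gt_left v1 0 Q1 _ (Hode1 Q1 ltac:(lra)) Hneg ltac:(lra))
      as [y [Hy Hvy]].
    assert (v1 y < l) by (eapply lt_l_before_Q; eauto; lra); lra. }
  assert (h S2 < h Q1) by (apply Hh; lra); lra. }
(* [v2] already exceeds [l] at [Q1], but not anywhere up to [Q2]. *)
assert (HQ : Q2 < Q1).
{ apply Rnot_le_lt; intros HQ.
  assert (H := Hlt Q1 ltac:(lra) ltac:(lra) ltac:(lra)).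
  destruct (Req_dec Q1 Q2) as [E|]; [rewrite E in *; lra|].
  assert (v2 Q1 < l) by (eapply lt_l_before_Q; eauto; lra); lra. }
(* The integral of [v2 - l] over [Q1] to [S1] exceeds [L] by comparison with [v1]; the pieces added
   on both sides are positive, so the total cannot be [L]. *)
assert (Hpos : forall b c, Q2 <= b -> b < c -> c <= S2 ->
  0 < RInt (fun x => v2 x - l) b c).
{ intros b c Hb Hbc Hc; apply RInt_gt_0; [lra| |].
  - intros x Hx; assert (l < v2 x) by (eapply gt_l_after_Q; eauto; lra); lra.
  - intros; eapply continuous_add_const; eauto. }
assert (Hint : RInt (fun x => v1 x - l) Q1 S1 < RInt (fun x => v2 x - l) Q1 S1).
{ apply RInt_lt; [lra| | |].
  - intros; eapply continuous_add_const; eauto.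
  - intros; eapply continuous_add_const; eauto.
  - intros x Hx; specialize (Hlt x ltac:(lra) ltac:(lra) ltac:(lra)); lra. }
assert (C1 := RInt_Chasles (fun x => v2 x - l) Q2 Q1 S1
  (ex_RInt_add_const _ _ _ _ _ Hv2 _ _ _) (ex_RInt_add_const _ _ _ _ _ Hv2 _ _ _)).
assert (C2 := RInt_Chasles (fun x => v2 x - l) Q2 S1 S2
  (ex_RInt_add_const _ _ _ _ _ Hv2 _ _ _) (ex_RInt_add_const _ _ _ _ _ Hv2 _ _ _)).
unfold plus in C1, C2; simpl in C1, C2.
assert (P1 := Hpos Q2 Q1 ltac:(lra) HQ ltac:(lra)).
assert (P2 := Hpos S1 S2 ltac:(lra) HS ltac:(lra)).
lra.
Qed.

(** With equal [gamma] the difference has derivative at most [M] times its absolute value, so a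
    strict order at 0 would persist up to the smaller of [q1] and [q2]. *)
Lemma initial_value_not_lt (q1 Q1 S1 q2 Q2 S2 gamma : R) (v1 v2 : R -> R) :
  solution q1 Q1 S1 gamma v1 -> solution q2 Q2 S2 gamma v2 -> ~ v1 0 < v2 0.
Proof.
intros Hv1 Hv2 H0.
apply (not_lt_before_q _ _ _ _ _ _ _ _ _ _ Hv1 Hv2); intros x Hx.
assert (Hm1 : Rmin q1 q2 <= q1) by apply Rmin_l.
assert (Hm2 : Rmin q1 q2 <= q2) by apply Rmin_r.
assert (B1 := Hv1); assert (B2 := Hv2).
destruct B1 as [Hq1 HqQ1 HQS1 Hc1 Hode1 _ _ _ _ _].
destruct B2 as [Hq2 HqQ2 HQS2 Hc2 Hode2 _ _ _ _ _].
assert (H : v1 x - v2 x < 0); [|lra].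
apply (gronwall_neg M (fun y => v1 y - v2 y)
  (fun y => (gamma - P (v1 y) - h y) - (gamma - P (v2 y) - h y)) 0 x);
  [exact HM| | |lra| |lra].
- intros y; apply (continuous_minus v1 v2); auto.
- intros y Hy; apply (is_derive_minus (V := R_NormedModule) v1 v2).
  + apply Hode1; lra.
  + apply Hode2; lra.
- intros y Hy; assert (Hlip := HP (v2 y) (v1 y)); rewrite Rabs_minus_sym in Hlip; lra.
Qed.

Lemma le_of_initial_value_le (q1 Q1 S1 q2 Q2 S2 gamma : R) (v1 v2 : R -> R) (x : R) :
  solution q1 Q1 S1 gamma v1 -> solution q2 Q2 S2 gamma v2 ->
  v1 0 <= v2 0 -> 0 <= x -> x <= S1 -> x <= S2 -> v1 x <= v2 x.
Proof.
intros Hv1 Hv2 H0 Hx Hx1 Hx2.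
assert (H : v1 x - v2 x <= 0); [|lra].
apply (gronwall_le M (fun y => v1 y - v2 y)
  (fun y => (gamma - P (v1 y) - h y) - (gamma - P (v2 y) - h y)) 0 x);
  [| |lra| |lra].
- intros y; apply (continuous_minus v1 v2).
  + apply (ns_continuous _ _ _ _ _ _ _ _ _ _ _ Hv1).
  + apply (ns_continuous _ _ _ _ _ _ _ _ _ _ _ Hv2).
- intros y Hy; apply (is_derive_minus (V := R_NormedModule) v1 v2).
  + apply (ns_ode _ _ _ _ _ _ _ _ _ _ _ Hv1); lra.
  + apply (ns_ode _ _ _ _ _ _ _ _ _ _ _ Hv2); lra.
- intros y Hy Hpos; assert (Hlip := HP (v2 y) (v1 y)).
  rewrite Rabs_minus_sym, Rabs_pos_eq in Hlip by lra; lra.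
Qed.

(** Agreement is stated up to both [S1] and [S2], whose equality is derived from it afterwards. *)
Lemma normalized_solution_eq (q1 Q1 S1 gamma1 q2 Q2 S2 gamma2 : R) (v1 v2 : R -> R)
    (x : R) :
  solution q1 Q1 S1 gamma1 v1 -> solution q2 Q2 S2 gamma2 v2 ->
  0 <= x -> x <= S1 -> x <= S2 -> v1 x = v2 x.
Proof.
intros Hv1 Hv2 Hx Hx1 Hx2.
assert (Hgamma : gamma1 = gamma2).
{ assert (H12 := gamma_not_lt _ _ _ _ _ _ _ _ _ _ Hv1 Hv2).
  assert (H21 := gamma_not_lt _ _ _ _ _ _ _ _ _ _ Hv2 Hv1); lra. }
subst gamma2.
assert (H12 := initial_value_not_lt _ _ _ _ _ _ _ _ _ Hv1 Hv2).
assert (H21 := initial_value_not_lt _ _ _ _ _ _ _ _ _ Hv2 Hv1).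
apply Rle_antisym.
- apply (le_of_initial_value_le _ _ _ _ _ _ _ _ _ _ Hv1 Hv2); lra.
- apply (le_of_initial_value_le _ _ _ _ _ _ _ _ _ _ Hv2 Hv1); lra.
Qed.

(** The common function crosses [- k] and [l] upwards at [q] and [Q] and returns to [l] at [S], so
    these points can be read off from it. Exchanging the solutions gives the reverse
    inequalities. *)
Lemma boundary_le (q1 Q1 S1 gamma1 q2 Q2 S2 gamma2 : R) (v1 v2 : R -> R) :
  solution q1 Q1 S1 gamma1 v1 -> solution q2 Q2 S2 gamma2 v2 ->
  q1 <= q2 /\ Q1 <= Q2 /\ S2 <= S1.
Proof.
intros Hv1 Hv2.
assert (B1 := Hv1); assert (B2 := Hv2).
destruct B1 as [Hq1 HqQ1 HQS1 _ _ _ _ Hvq1 HvQ1 HvS1].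
destruct B2 as [Hq2 HqQ2 HQS2 _ _ _ _ Hvq2 HvQ2 HvS2].
assert (Heq : forall x, 0 <= x -> x <= S1 -> x <= S2 -> v1 x = v2 x).
{ intros x; apply (normalized_solution_eq _ _ _ _ _ _ _ _ _ _ _ Hv1 Hv2). }
assert (HS : S2 <= S1).
{ apply Rnot_lt_le; intros HS.
  (* This places [S1] strictly between [Q2] and [S2], where [v2] exceeds [l]. *)
  assert (HQ : Q2 <= Q1).
  { apply Rnot_lt_le; intros HQ.
    assert (v2 Q1 < l) by (eapply lt_l_before_Q; eauto; lra).
    rewrite (Heq Q1) in HvQ1 by lra; lra. }
  assert (l < v2 S1) by (eapply gt_l_after_Q; eauto; lra).
  rewrite (Heq S1) in HvS1 by lra; lra. }
split; [|split; [|exact HS]]; apply Rnot_lt_le; intros Hlt.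
- assert (v1 q2 < - k) by (eapply lt_k_before_q; eauto; lra).
  rewrite <- (Heq q2) in Hvq2 by lra; lra.
- assert (v1 Q2 < l) by (eapply lt_l_before_Q; eauto; lra).
  rewrite <- (Heq Q2) in HvQ2 by lra; lra.
Qed.

End NormalizedUniqueness.

(** * Uniqueness for the original problem *)

Theorem corollary1
    (sigma K k L l : R) (hsigma : 0 < sigma ^ 2)
    (hK : 0 < K) (hk : 0 < k) (hL : 0 < L) (hl : 0 < l)
    (U : R -> Prop) (mu_min mu_max : R) (hU : drift_set U mu_min mu_max)
    (c h : R -> R) (hh : holding_cost h)
    (q1 Q1 S1 gamma1 : R) (w1 : R -> R)
    (q2 Q2 S2 gamma2 : R) (w2 : R -> R)
    (sol1 : free_boundary_solution sigma K k L l U c h q1 Q1 S1 gamma1 w1)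
    (sol2 : free_boundary_solution sigma K k L l U c h q2 Q2 S2 gamma2 w2) :
  q1 = q2 /\ Q1 = Q2 /\ S1 = S2 /\ (forall x, 0 <= x <= S1 -> w1 x = w2 x).
Proof.
destruct hU as [_ [_ [[Umin Hmin] [_ Hmax]]]]; destruct hh as [Hinc _].
assert (Ha : 0 < sigma ^ 2 / 2) by lra.
apply normalize_solution in sol1; [|exact hsigma].
apply normalize_solution in sol2; [|exact hsigma].
(* The slopes in [U] lie between its extreme elements, so [M] bounds their absolute values. *)
set (M := Rmax (Rabs mu_min) (Rabs mu_max)).
assert (HM : forall mu, U mu -> Rabs mu <= M).
{ intros mu Hmu; apply RmaxAbs; auto. }
assert (HM0 : 0 <= M) by (apply Rle_trans with (2 := HM _ Umin), Rabs_pos).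
assert (HP : lipschitz (M / (sigma ^ 2 / 2))
               (fun y => drift_min U c y / (sigma ^ 2 / 2))).
{ intros x y; unfold Rdiv; rewrite <- Rmult_minus_distr_r.
  replace (M * / (sigma ^ 2 * / 2) * Rabs (x - y))
    with (M * Rabs (x - y) * / (sigma ^ 2 * / 2)) by ring.
  apply Rmult_le_compat_r; [apply Rlt_le, Rinv_0_lt_compat, Ha|].
  exact (drift_min_lipschitz U c M mu_min Umin HM x y). }
assert (Hh : forall x y, 0 <= x -> x < y ->
  h x / (sigma ^ 2 / 2) < h y / (sigma ^ 2 / 2)).
{ intros x y Hx Hxy; apply Rmult_lt_compat_r; [apply Rinv_0_lt_compat, Ha | auto]. }
assert (HMa : 0 <= M / (sigma ^ 2 / 2)) by (apply Rdiv_le_0_compat; lra).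
destruct (boundary_le K k L l hk hl _ _ _ HMa HP Hh _ _ _ _ _ _ _ _ _ _ sol1 sol2)
  as [Hq12 [HQ12 HS12]].
destruct (boundary_le K k L l hk hl _ _ _ HMa HP Hh _ _ _ _ _ _ _ _ _ _ sol2 sol1)
  as [Hq21 [HQ21 HS21]].
repeat split; try lra.
intros x Hx.
assert (E := normalized_solution_eq K k L l hk hl _ _ _ HMa HP Hh
  _ _ _ _ _ _ _ _ _ _ x sol1 sol2 ltac:(lra) ltac:(lra) ltac:(lra)).
simpl in E; rewrite Rmax_right in E by lra; exact E.
Qed.
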